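(* \[\alpha_{1,2}=\frac87.\] The maximum is achieved by blowups of the looped graph $G=J_3\vee C_4$: for each $t\ge1$ the $t$-blowup $G(t)$, a looped graph on $n=7t$ vertices, satisfies $\lambda_1(G(t))+\lambda_2(\overline{G(t)})=\frac87 n$.
   Context: For a graph on $n$ vertices, $\lambda_1\ge\cdots\ge\lambda_n$ are the eigenvalues of its adjacency matrix. Let $\mathcal G_n$ be the family of simple (loopless) graphs on $n$ vertices, with $\overline{G}$ the usual simple complement. For fixed positive integers $i,j$, \[\alpha_{i,j}=\lim_{n\to\infty}\frac1n\max_{G\in\mathcal G_n}\bigl(\lambda_i(G)+\lambda_j(\overline{G})\bigr),\] a limit which is known to exist (Nikiforov). A looped graph is an undirected graph without multiple edges in which each vertex may carry at most one loop; a loop gives diagonal entry $1$ in the adjacency matrix $A(G)$. The complement of a looped graph on $n$ vertices is defined by $A(G)+A(\overline{G})=J_n$ (the all-ones matrix). The $t$-blowup $G(t)$ of a looped graph $G$ on vertices $1,\dots,m$ has vertices $v_{i,a}$ ($1\le i\le m$, $1\le a\le t$), with $v_{i,a}v_{j,b}$ an edge iff $ij\in E(G)$ (for $i=j$: iff $i$ has a loop, and then $v_{i,a}v_{i,b}$ is an edge for all $a,b$, including loops $a=b$). $J_3$ as a graph is the complete graph on 3 vertices with a loop at each vertex, $C_4$ is the loopless 4-cycle, and $\vee$ denotes join (disjoint union plus all edges between the two parts). *)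

(* Defs.v *)
From mathcomp Require Import all_boot all_order all_algebra.
From mathcomp Require Import polyrcf.
From mathcomp Require Import all_classical all_reals all_analysis.
Import Order.TTheory GRing.Theory Num.Theory numFieldNormedType.Exports.

Set Implicit Arguments.
Unset Strict Implicit.
Unset Printing Implicit Defensive.

Local Open Scope ring_scope.

(* A looped graph with vertex set T is a symmetric e : rel T; a loop at x is
   e x x. A simple graph is a looped graph that is moreover irreflexive. *)

Definition adjmx (R : nzRingType) (T : finType) (e : rel T) : 'M[R]_#|T| :=
  \matrix_(i, j) (e (enum_val i) (enum_val j))%:R.

(* The real eigenvalues, repeated according to algebraic multiplicity, in
   decreasing order; for a symmetric matrix these are all the eigenvalues. *)
Definition eigvals (R : rcfType) (n : nat) (A : 'M[R]_n) : seq R :=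
  sort >=%R
    (flatten [seq nseq (mup x (char_poly A)) x | x <- rootsR (char_poly A)]).

(* Numbered from 1, as usual: meaningful for 1 <= k <= #|T|, and 0 when
   #|T| < k. *)
Definition lambda (R : rcfType) (k : nat) (T : finType) (e : rel T) : R :=
  nth 0 (eigvals (adjmx R e)) k.-1.

Definition simple_compl (T : finType) (e : rel T) : rel T :=
  [rel x y | (x != y) && ~~ e x y].

Definition looped_compl (T : finType) (e : rel T) : rel T :=
  [rel x y | ~~ e x y].

Lemma adjmx_looped_compl (R : nzRingType) (T : finType) (e : rel T) :
  adjmx R e + adjmx R (looped_compl e) = const_mx 1.
Proof.
apply/matrixP => i j; rewrite !mxE /looped_compl /=.
by case: (e _ _); rewrite ?(addr0, add0r).
Qed.

Definition blowup (t : nat) (T : finType) (e : rel T) : rel (T * 'I_t)%type :=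
  [rel u v | e u.1 v.1].
Arguments blowup t {T} e.

Definition join (T1 T2 : finType) (e1 : rel T1) (e2 : rel T2) :
    rel (T1 + T2)%type :=
  fun u v => match u, v with
             | inl x, inl y => e1 x y
             | inr x, inr y => e2 x y
             | _, _ => true
             end.

Definition J_graph (n : nat) : rel 'I_n := fun _ _ => true.

Definition cycle_graph (n : nat) : rel 'I_n :=
  [rel x y : 'I_n | (y == x.+1 %% n :> nat)%N || (x == y.+1 %% n :> nat)%N].

Definition J3_join_C4 : rel ('I_3 + 'I_4)%type :=
  join (@J_graph 3) (@cycle_graph 4).

(* Simple graphs on 'I_n are encoded by their boolean adjacency matrices,
   which form a finite type, so that a maximum over them makes sense. *)
Definition is_simple (n : nat) (E : 'M[bool]_n) : bool :=
  (E^T == E) && [forall x, ~~ E x x].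

Definition lambda_sum (R : rcfType) (i j n : nat) (E : 'M[bool]_n) : R :=
  lambda R i E + lambda R j (simple_compl E).

(* The search for a maximizer starts from the edgeless graph. *)
Definition max_lambda_sum (R : rcfType) (i j n : nat) : R :=
  lambda_sum R i j
    [arg max_(E > (const_mx false : 'M[bool]_n) | is_simple E)
       lambda_sum R i j E]%O.

Definition alpha_seq (R : realType) (i j : nat) : R^nat :=
  fun n => max_lambda_sum R i j n / n%:R.

Definition alpha (R : realType) (i j : nat) : R := limn (alpha_seq R i j).

(* Main.v *)
(* Upper bound.  Let A, B be symmetric and nonnegative with A + B <= 1
   entrywise, let t be the top eigenvalue of A and mu > 0 the second one of B.
   The entrywise absolute value f of a t-eigenvector satisfies A f >= t f, and
   the signs of the first two eigenvectors of B give nonnegative g, h with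
   disjoint supports such that B g >= mu g on supp g, and likewise for h.
   With F, G the sums of f, g, the numbers F - t f_i >= (B f)_i and G - mu g_i
   (for i in supp g) are nonnegative; summing their products over supp g, with
   <f, g> <= F G / (t + mu), bounds t * sum_(supp g) f by
   F (|supp g| - mu^2 / (t + mu)).  Adding the same for h and t f_i <= F
   elsewhere gives t <= n - 2 mu^2 / (t + mu), hence t + mu <= 8 n / 7.

   Lower bound.  On blowups of J_3 v C_4 use the vector equal to 4 on J_3 and 3
   on C_4 (eigenvalue 6), and on the complement the indicators of the two pairs
   of opposite vertices of C_4 (eigenvalue 2); removing the loops costs at most
   1 in each of the two eigenvalues. *)
Require Import Defs.
From mathcomp Require Import all_boot all_order all_algebra.
From mathcomp Require Import polyrcf complex spectral ring lra zify.
From mathcomp Require Import all_classical all_reals all_analysis.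
Import Order.TTheory GRing.Theory Num.Theory numFieldNormedType.Exports.
Set Implicit Arguments.
Unset Strict Implicit.
Unset Printing Implicit Defensive.
Local Open Scope ring_scope.

(** * Orthogonal diagonalization of real symmetric matrices *)

Lemma dot_ge0 (R : realDomainType) n (u : 'rV[R]_n) : 0 <= (u *m u^T) 0 0.
Proof. by rewrite mxE sumr_ge0 // => i _; rewrite mxE -expr2 sqr_ge0. Qed.

Lemma dot_eq0 (R : realDomainType) n (u : 'rV[R]_n) :
  ((u *m u^T) 0 0 == 0) = (u == 0).
Proof.
apply/idP/eqP => [|->]; last by rewrite mul0mx mxE.
rewrite mxE psumr_eq0 => [/allP u0|i _]; last by rewrite mxE -expr2 sqr_ge0.
apply/rowP => i; rewrite mxE; apply/eqP; rewrite -sqrf_eq0 expr2.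
by have := u0 i (mem_index_enum i); rewrite mxE.
Qed.

Lemma dotC (R : comNzRingType) n (u v : 'rV[R]_n) : u *m v^T = v *m u^T.
Proof. by rewrite -[LHS]trmxK trmx_mul trmxK [LHS]mx11_scalar mxE -mx11_scalar. Qed.

(** An eigenvalue exists over [R[i]], and hermitian symmetry makes it real. As a real root of the
    characteristic polynomial it has an eigenvector over [R] itself, which is then normalized. *)
Lemma sym_eigenvector (R : rcfType) n (A : 'M[R]_n.+1) : A^T = A ->
  exists a (w : 'rV_n.+1), w *m w^T = 1%:M /\ w *m A = a *: w.
Proof.
move=> symA; pose Ac := map_mx (real_complex R) A.
have hA : Ac \is hermsymmx.
  apply: realsym_hermsym.
    apply/is_hermitianmxP; rewrite expr0 scale1r map_mx_id //.
    by rewrite map_trmx symA.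
  by apply/mxOverP => i j; rewrite !mxE; apply/complex_realP; exists (A i j).
have [z] := eigenvalue_closed Ac (ltn0Sn n).
move=> /eigenvalueP [v vA v0].
have zr : z \is Num.real.
  have vv0 : 0 < dotmx v v by exact: dotmx_is_dotmx.
  move: vv0; rewrite dotmxE => /lt0r_neq0 vv0.
  have /is_hermitianmxP := hA; rewrite expr0 scale1r => Ah.
  (* Evaluating the same form with [Ac] acting on either side gives [z] and its conjugate times the
     squared norm of [v]. *)
  have E1 : v *m Ac *m (map_mx Num.conj v^T) = z *: (v *m map_mx Num.conj v^T).
    by rewrite vA scalemxAl.
  have E2 : v *m Ac *m (map_mx Num.conj v^T) =
            z^* *: (v *m map_mx Num.conj v^T).
    rewrite -mulmxA {1}Ah -map_mxM -trmx_mul vA linearZ /=.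
    by rewrite map_mxZ scalemxAr.
  apply/CrealP; apply: (mulIf vv0).
  by have /matrixP/(_ 0 0) := etrans (esym E2) E1; rewrite [LHS]mxE [RHS]mxE.
have /complex_realP [a za] := zr.
have : root (char_poly Ac) z.
  by rewrite -eigenvalue_root_char; apply/eigenvalueP; exists v.
rewrite za -map_char_poly fmorph_root.
rewrite -eigenvalue_root_char => /eigenvalueP [w wA w0].
have := mx11_scalar (w *m w^T); set k := (w *m w^T) 0 0 => Ek.
have k0 : 0 < k by rewrite lt_def dot_eq0 w0 dot_ge0.
exists a, ((Num.sqrt k)^-1 *: w); split; last first.
  by rewrite -scalemxAl wA !scalerA mulrC.
rewrite linearZ -scalemxAl -scalemxAr scalerA -invfM -expr2 sqr_sqrtr ?ltW //.
by rewrite Ek scale_scalar_mx mulVf // gt_eqF.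
Qed.

(** For [w] different from the first basis vector [e], the reflection along [w - e] exchanges these
    two unit vectors. It serves to move an eigenvector onto the first axis. *)
Lemma householder (R : rcfType) n (w : 'rV[R]_n.+1) : w *m w^T = 1%:M ->
  exists Q : 'M[R]_n.+1, [/\ Q^T = Q, Q *m Q = 1%:M & w *m Q = delta_mx 0 0].
Proof.
move=> w1; set e := delta_mx 0 0.
have [->|we] := eqVneq w e; first by exists 1%:M; rewrite trmx1 !mulmx1.
have [u uE] : {u | u = w - e} by exists (w - e).
pose k := (u *m u^T) 0 0.
have k0 : k != 0 by rewrite dot_eq0 uE subr_eq0.
have ee : e *m e^T = 1%:M.
  rewrite trmx_delta mul_delta_mx.
  by apply/matrixP => i j; rewrite !ord1 !mxE.
(* Equal norms make the product of [w] with [u] half the squared norm of [u], so the reflection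
   subtracts exactly [u] from [w]. *)
have we0 : w *m u^T = (k / 2)%:M.
  have -> : k = 2 * (w *m u^T) 0 0.
    rewrite /k uE linearB /= mulmxBl !mulmxBr w1 ee (dotC e w) !mxE /=.
    ring.
  by rewrite mulrAC divff ?pnatr_eq0 // mul1r -mx11_scalar.
exists (1%:M - (2 / k) *: (u^T *m u)); split.
- by rewrite linearB linearZ /= trmx1 trmx_mul trmxK.
- rewrite mulmxBl mul1mx mulmxBr mulmx1 -scalemxAl -scalemxAr -mulmxA.
  rewrite (mulmxA u) [u *m u^T]mx11_scalar -/k mul_scalar_mx -scalemxAr !scalerA.
  rewrite -scalerBl -addrA -opprD -scalerDl.
  rewrite (_ : 2 / k + _ = 0) ?scale0r ?subr0 //.
  by field.
- rewrite mulmxBr mulmx1 -scalemxAr mulmxA we0 mul_scalar_mx scalerA.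
  rewrite (_ : 2 / k * (k / 2) = 1) ?scale1r; last by field; rewrite k0.
  by rewrite uE subKr.
Qed.

(** Deflation: once a unit eigenvector is reflected to the first axis, symmetry makes the matrix
    block diagonal, and induction applies to the lower block. *)
Lemma sym_orthodiag (R : rcfType) n (A : 'M[R]_n) : A^T = A ->
  exists (P : 'M[R]_n) d, P *m P^T = 1%:M /\ P *m A = diag_mx d *m P.
Proof.
elim: n A => [|n IHn] A symA.
  by exists 1%:M, 0; split; apply/matrixP => -[].
have [a [w [w1 wA]]] := sym_eigenvector symA.
have [Q [Qs QQ wQ]] := householder w1.
have eQ : delta_mx 0 0 *m Q = w by rewrite -wQ -mulmxA QQ mulmx1.
pose B : 'M[R]_(1 + n) := Q *m A *m Q.
have symB : B^T = B by rewrite !trmx_mul Qs symA mulmxA.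
have B0 : row 0 B = a *: delta_mx 0 0.
  by rewrite rowE !mulmxA eQ wA -scalemxAl wQ.
have Bur : ursubmx B = 0.
  apply/matrixP => i j; rewrite !mxE ord1.
  have /rowP/(_ (rshift 1 j)) := B0; rewrite !mxE !eqxx /=.
  by rewrite (_ : lshift n 0 = 0) ?mulr0 => [->|]; last exact/val_inj.
have Bdl : dlsubmx B = 0 by rewrite -[LHS]trmxK trmx_dlsub symB Bur trmx0.
have [|P' [d' [P1 P2]]] := IHn (drsubmx B); first by rewrite trmx_drsub symB.
pose P : 'M[R]_(1 + n) := block_mx 1%:M 0 0 P'.
have PP : P *m P^T = 1%:M.
  rewrite tr_block_mx mulmx_block !(trmx1, trmx0).
  by rewrite !(mulmx1, mulmx0, mul0mx, addr0, add0r) P1 -scalar_mx_block.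
have PB : P *m B = diag_mx (row_mx (ulsubmx B) d') *m P.
  rewrite -{1}[B]submxK Bur Bdl diag_mx_row !mulmx_block.
  rewrite !(mulmx1, mul1mx, mulmx0, mul0mx, addr0, add0r) P2.
  congr (block_mx _ _ _ _); apply/matrixP => i j.
  by rewrite !ord1 [RHS]mxE eqxx.
exists (P *m Q), (row_mx (ulsubmx B) d'); split.
  by rewrite trmx_mul Qs mulmxA -(mulmxA P) QQ mulmx1 PP.
have -> : P *m Q *m A = P *m B *m Q.
  by rewrite /B !mulmxA -(mulmxA _ Q Q) QQ mulmx1.
by rewrite PB mulmxA.
Qed.

(** * The sorted eigenvalues and a matching orthonormal eigenbasis *)

Lemma char_poly_orthodiag (R : fieldType) n (A P : 'M[R]_n) d :
  P *m P^T = 1%:M -> P *m A = diag_mx d *m P ->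
  char_poly A = \prod_(x <- [seq d 0 i | i <- enum 'I_n]) ('X - x%:P).
Proof.
move=> PP PA; have PPp : map_mx polyC P *m map_mx polyC P^T = 1%:M.
  by rewrite -map_mxM PP map_mx1.
transitivity (char_poly (diag_mx d)).
  rewrite /char_poly -[LHS]mul1r -(det1 {poly R} n) -PPp det_mulmx mulrAC.
  rewrite -det_mulmx /char_poly_mx mulmxBr -map_mxM PA map_mxM.
  rewrite scalar_mxC -mulmxBl det_mulmx -mulrA -det_mulmx.
  by rewrite PPp det1 mulr1.
rewrite char_poly_trig ?diag_mx_is_trig // big_map big_enum /=.
by apply: eq_bigr => i _; rewrite mxE eqxx.
Qed.

(** For a split polynomial the multiplicity of a root is its number of occurrences in [s]. *)
Lemma perm_eigvals (R : rcfType) n (A : 'M[R]_n) (s : seq R) :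
  char_poly A = \prod_(x <- s) ('X - x%:P) -> perm_eq (eigvals A) s.
Proof.
move=> As; rewrite /eigvals perm_sort.
have p0 : char_poly A != 0 by rewrite monic_neq0 // char_poly_monic.
apply: perm_trans (perm_count_undup s).
rewrite (eq_map (g := fun x => nseq (count_mem x s) x)); last first.
  by move=> x; rewrite As mu_prod_XsubC.
apply/perm_flatten/perm_map/uniq_perm; rewrite ?uniq_roots ?undup_uniq //.
move=> x; have /roots_onP/(_ x) := roots_on_rootsR p0.
by rewrite mem_undup in_itv /= [X in root X]As root_prod_XsubC => ->.
Qed.

(** [sym_orthodiag] gives the eigenvalues in an unknown order; permuting the rows of its matrix
    aligns them with [eigvals]. *)
Lemma sym_spectral (R : rcfType) n (A : 'M[R]_n) : A^T = A ->
  exists P : 'M[R]_n, P *m P^T = 1%:M /\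
    forall i, row i P *m A = (eigvals A)`_i *: row i P.
Proof.
move=> symA; have [P [d [P1 P2]]] := sym_orthodiag symA.
have := perm_eigvals (char_poly_orthodiag P1 P2).
case/(perm_iotaP 0) => l lP; rewrite size_map size_enum_ord in lP *.
move=> el.
have sl : size l = n by rewrite (perm_size lP) size_iota.
have lt_l i : (i < n)%N -> (nth 0%N l i < n)%N.
  move=> lt_in; have : nth 0%N l i \in l by rewrite mem_nth ?sl.
  by rewrite (perm_mem lP) mem_iota.
pose f (i : 'I_n) := Ordinal (lt_l i (ltn_ord i)).
have f_inj : injective f.
  move=> i j [/eqP]; rewrite nth_uniq ?sl ?(perm_uniq lP) ?iota_uniq //.
  by move/eqP/val_inj.
exists (rowsub f P); split.
  apply/matrixP => i j; have /matrixP/(_ (f i) (f j)) := P1.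
  rewrite !mxE (inj_eq f_inj) => <-.
  by apply: eq_bigr => k _; rewrite !mxE.
move=> i; rewrite row_rowsub rowE -mulmxA P2 mulmxA -rowE row_diag_mx.
rewrite -scalemxAl -rowE; congr (_ *: _).
rewrite el (nth_map 0%N) ?sl // (nth_map (f i)) ?size_enum_ord ?lt_l //.
by congr (d _ _); apply: val_inj; rewrite /= nth_enum_ord ?lt_l.
Qed.

Lemma size_eigvals (R : rcfType) n (A : 'M[R]_n) : A^T = A ->
  size (eigvals A) = n.
Proof.
move=> symA; have [P [d [P1 P2]]] := sym_orthodiag symA.
rewrite (perm_size (perm_eigvals (char_poly_orthodiag P1 P2))).
by rewrite size_map size_enum_ord.
Qed.

Lemma eigvals_nonincr (R : rcfType) n (A : 'M[R]_n) i j : A^T = A ->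
  (i <= j < n)%N -> (eigvals A)`_j <= (eigvals A)`_i.
Proof.
move=> symA /andP[le_ij lt_jn].
have ge_tr : transitive (>=%R : rel R) by move=> x y z xy /le_trans; apply.
have /(sorted_leq_nth ge_tr (@lexx _ R)) le_nth : sorted >=%R (eigvals A).
  by apply: sort_sorted => x y; exact: le_total.
by apply: le_nth; rewrite // inE size_eigvals // (leq_ltn_trans le_ij).
Qed.

(** * Rayleigh quotients and lower bounds for the first two eigenvalues *)

(** In the eigenbasis [x] has no coordinate of index below [k], and all later eigenvalues are at
    most the one of index [k], counted from 0. *)
Lemma rayleigh_le_eigval (R : rcfType) n (A P : 'M[R]_n) (x : 'rV_n) k :
  A^T = A -> P *m P^T = 1%:M ->
  (forall i, row i P *m A = (eigvals A)`_i *: row i P) ->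
  (forall i : 'I_n, (i < k)%N -> (x *m P^T) 0 i = 0) ->
  (x *m A *m x^T) 0 0 <= (eigvals A)`_k * (x *m x^T) 0 0.
Proof.
move=> symA PP PA; have [y yE] : {y | y = x *m P^T} by exists (x *m P^T).
rewrite -yE => y0.
have P'P : P^T *m P = 1%:M by apply: mulmx1C.
have xE : x = y *m P by rewrite yE -mulmxA P'P mulmx1.
have yA : x *m A = (\row_i ((eigvals A)`_i * y 0 i)) *m P.
  rewrite xE -mulmxA; apply/rowP => j; rewrite !mxE.
  apply: eq_bigr => i _; rewrite mxE mulrAC [RHS]mulrC [in RHS]mulrC.
  have /rowP/(_ j) := PA i; rewrite -row_mul !mxE => ->.
  by rewrite [RHS]mulrC mulrA.
have -> : x *m A *m x^T = (\row_i ((eigvals A)`_i * y 0 i)) *m y^T.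
  by rewrite yA yE trmx_mul trmxK mulmxA.
have -> : x *m x^T = y *m y^T by rewrite {1}xE yE trmx_mul trmxK mulmxA.
rewrite !mxE mulr_sumr ler_sum // => i _; rewrite !mxE -mulrA -expr2.
have [lt_ik|le_ki] := ltnP i k; first by rewrite y0 // expr0n /= !mulr0.
by rewrite ler_wpM2r ?sqr_ge0 ?eigvals_nonincr // le_ki ltn_ord.
Qed.

Lemma le_eigval0 (R : rcfType) n (A : 'M[R]_n) (x : 'rV_n) c :
  A^T = A -> x != 0 -> c * (x *m x^T) 0 0 <= (x *m A *m x^T) 0 0 ->
  c <= (eigvals A)`_0.
Proof.
move=> symA x0 cx; have [P [PP PA]] := sym_spectral symA.
have xx : 0 < (x *m x^T) 0 0 by rewrite lt_def dot_eq0 x0 dot_ge0.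
rewrite -(ler_pM2r xx); apply: le_trans cx _.
exact: (rayleigh_le_eigval symA PP PA).
Qed.

(** The plane spanned by [f] and [g] contains a nonzero vector orthogonal to the top eigenvector, to
    which [rayleigh_le_eigval] applies. *)
Lemma le_eigval1 (R : rcfType) n (A : 'M[R]_n) (f g : 'rV_n) c :
  A^T = A ->
  (forall a b, (a != 0) || (b != 0) -> let x := a *: f + b *: g in
     x != 0 /\ c * (x *m x^T) 0 0 <= (x *m A *m x^T) 0 0) ->
  c <= (eigvals A)`_1.
Proof.
move=> symA fg; have [P [PP PA]] := sym_spectral symA.
have [a [b [ab xP]]] : exists a b, (a != 0) || (b != 0) /\
    forall i : 'I_n, (i < 1)%N -> ((a *: f + b *: g) *m P^T) 0 i = 0.
  case: n => [|n] in A f g symA fg P PP PA *.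
    by exists 1, 1; rewrite oner_neq0; split=> // i; have := ltn_ord i; rewrite ltn0.
  pose p := (f *m P^T) 0 0; pose q := (g *m P^T) 0 0.
  have [/andP[/eqP p0 /eqP q0]|pq0] := boolP ((p == 0) && (q == 0)).
    exists 1, 1; rewrite oner_neq0; split=> // i i0.
    have -> : i = 0 by apply: val_inj; move: i0; rewrite ltnS leqn0 => /eqP.
    by rewrite mulmxDl !scale1r mxE -/p -/q p0 q0 addr0.
  (* The product with the top eigenvector is [q * p - p * q]. *)
  exists q, (- p); rewrite oppr_eq0 orbC -negb_and; split=> // i i0.
  have -> : i = 0 by apply: val_inj; move: i0; rewrite ltnS leqn0 => /eqP.
  by rewrite mulmxDl -!scalemxAl mxE [X in X + _]mxE [X in _ + X]mxE -/p -/q mulNr mulrC subrr.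
have [x0 cx] := fg a b ab.
set x := a *: f + b *: g in x0 cx xP.
have xx : 0 < (x *m x^T) 0 0 by rewrite lt_def dot_eq0 x0 dot_ge0.
rewrite -(ler_pM2r xx); apply: le_trans cx _.
exact: (rayleigh_le_eigval symA PP PA).
Qed.

(** * The upper bound for nonnegative matrices with [A + B <= 1] *)

(** The inequality is stated on the support, where the positive part of an eigenvector inherits
    it. *)
Definition subeigen (R : realFieldType) (I : finType) (B : I -> I -> R)
    (mu : R) (g : I -> R) :=
  [/\ forall i, 0 <= g i, 0 < \sum_i g i &
      forall i, 0 < g i -> mu * g i <= \sum_j B i j * g j].

Lemma sum_prod_affine (R : comPzRingType) (I : finType) (P : pred I)
    (x y : I -> R) a b c d :
  \sum_(i | P i) (a - c * x i) * (b - d * y i) =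
  #|P|%:R * (a * b) - d * a * \sum_(i | P i) y i -
  c * b * \sum_(i | P i) x i + c * d * \sum_(i | P i) x i * y i.
Proof.
rewrite -sumr_const mulr_suml !mulr_sumr -!sumrB -big_split /=.
by apply: eq_bigr => i _; ring.
Qed.

Section ComplementaryMatrices.
Context {R : realFieldType} {I : finType}.
Variables A B : I -> I -> R.
Hypotheses (symB : forall i j, B i j = B j i) (A0 : forall i j, 0 <= A i j)
  (B0 : forall i j, 0 <= B i j) (AB1 : forall i j, A i j + B i j <= 1).
Variables (t : R) (f : I -> R).
Hypotheses (t0 : 0 <= t) (f0 : forall i, 0 <= f i) (F0 : 0 < \sum_i f i)
  (Af : forall i, t * f i <= \sum_j A i j * f j).

Let F := \sum_i f i.

(** Since [f >= 0] and [A + B <= 1] entrywise, row [i] of [A f + B f] is at most [F]. *)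
Lemma defect_ge i : \sum_j B i j * f j <= F - t * f i.
Proof.
rewrite lerBrDr (le_trans (lerD (lexx _) (Af i))) // -big_split /=.
by apply: ler_sum => j _; rewrite -mulrDl ler_piMl // addrC.
Qed.

Lemma defect_ge0 i : 0 <= F - t * f i.
Proof.
by apply: le_trans (defect_ge i); rewrite sumr_ge0 // => j _; rewrite mulr_ge0.
Qed.

Lemma subeigenvalue_le_card : t <= #|I|%:R.
Proof.
rewrite -(ler_pM2r F0) mulr_sumr mulr_natl -sumr_const ler_sum // => i _.
by have := defect_ge0 i; rewrite subr_ge0.
Qed.

Lemma support_bound mu g : 0 < mu -> subeigen B mu g ->
  (t + mu) * (t * \sum_(i | 0 < g i) f i) <=
  F * ((t + mu) * #|[pred i | 0 < g i]|%:R - mu ^+ 2).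
Proof.
move=> mu0 [g0 G0 Bg]; set G := \sum_i g i in G0.
set D := \sum_i f i * g i; set FP := \sum_(i | 0 < g i) f i.
set p := _%:R.
have supp i : ~~ (0 < g i) -> g i = 0.
  by rewrite lt_def g0 andbT negbK => /eqP.
have suppE (E : I -> R) : \sum_(i | 0 < g i) E i * g i = \sum_i E i * g i.
  rewrite [RHS](bigID (fun i => 0 < g i)) /= [X in _ + X]big1 ?addr0 // => i.
  by move/supp ->; rewrite mulr0.
(* Pairing [defect_ge] with [g] bounds [<g, B f>] by [F * G - t * D]; by symmetry it equals
   [<f, B g>], which is at least [mu * D]. *)
have DG : (t + mu) * D <= F * G.
  have : \sum_i g i * (\sum_j B i j * f j) <= \sum_i g i * (F - t * f i).
    by apply: ler_sum => i _; rewrite ler_wpM2l ?defect_ge.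
  have -> : \sum_i g i * (F - t * f i) = F * G - t * D.
    rewrite /G /D !mulr_sumr -sumrB; apply: eq_bigr => i _; ring.
  have -> : \sum_i g i * (\sum_j B i j * f j) =
            \sum_j f j * (\sum_i B j i * g i).
    under eq_bigr do rewrite mulr_sumr.
    rewrite exchange_big; apply: eq_bigr => j _ /=; rewrite mulr_sumr.
    by apply: eq_bigr => i _; rewrite symB; ring.
  have : mu * D <= \sum_j f j * (\sum_i B j i * g i).
    rewrite /D mulr_sumr ler_sum // => j _.
    rewrite mulrCA ler_wpM2l //; have [/Bg //|/supp gj0] := boolP (0 < g j).
    by rewrite gj0 mulr0 sumr_ge0 // => i _; rewrite mulr_ge0.
  lra.
have G_ge i : 0 < g i -> 0 <= G - mu * g i.
  move=> /Bg Bgi; rewrite subr_ge0 (le_trans Bgi) // ler_sum // => j _.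
  by rewrite ler_piMl //; have := A0 i j; have := AB1 i j; lra.
have : 0 <= \sum_(i | 0 < g i) (F - t * f i) * (G - mu * g i).
  by apply: sumr_ge0 => i gi; rewrite mulr_ge0 ?defect_ge0 ?G_ge.
(* Writing [g i] as [1 * g i] lets [suppE] also extend the plain sum of [g] to all indices. *)
rewrite sum_prod_affine suppE (eq_bigr (fun i => 1 * g i)) => [|i _]; last first.
  by rewrite mul1r.
rewrite suppE (eq_bigr g) => [|i _]; last by rewrite mul1r.
rewrite -/G -/FP -/D -/p.
move=> S0; rewrite -(ler_pM2l G0).
have s0 : 0 < t + mu by rewrite ltr_wpDl.
(* Replacing [D] by [F * G / (t + mu)] leaves the coefficient [- mu + t * mu / (t + mu) = - mu ^+ 2
   / (t + mu)]. *)
have := mulr_ge0 (ltW s0) S0.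
have := ler_wpM2l (mulr_ge0 t0 (ltW mu0)) DG.
nra.
Qed.

Lemma disjoint_supports_bound mu g h : 0 < mu ->
  subeigen B mu g -> subeigen B mu h -> (forall i, 0 < g i -> h i = 0) ->
  7 * (t + mu) <= 8 * #|I|%:R.
Proof.
move=> mu0 sg sh gh; set n := #|I|%:R.
have bg := support_bound mu0 sg; have bh := support_bound mu0 sh.
set p := #|_|%:R in bg; set q := #|_|%:R in bh.
set P := fun i => 0 < g i; set Q := fun i => 0 < h i.
have disj i : P i -> ~~ Q i by move=> /gh; rewrite /Q => ->; rewrite ltxx.
have split3 (E : I -> R) : \sum_i E i =
    \sum_(i | P i) E i + \sum_(i | Q i) E i + \sum_(i | ~~ P i && ~~ Q i) E i.
  rewrite (bigID P) /= (bigID Q (fun i => ~~ P i)) /= addrA; congr (_ + _ + _).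
  by apply: eq_bigl => i; case: (boolP (P i)) => // /disj /negbTE ->.
have nE : n = p + q + \sum_(i | ~~ P i && ~~ Q i) 1.
  by rewrite /n -sumr_const split3 !sumr_const.
have FE := split3 f; rewrite -/F in FE.
have rest : t * \sum_(i | ~~ P i && ~~ Q i) f i <=
            F * \sum_(i | ~~ P i && ~~ Q i) 1.
  rewrite !mulr_sumr ler_sum // => i _; rewrite mulr1 -subr_ge0.
  exact: defect_ge0.
have s0 : 0 < t + mu by rewrite ltr_wpDl.
have main : F * ((t + mu) * t) <= F * ((t + mu) * n - 2 * mu ^+ 2).
  have := ler_wpM2l (ltW s0) rest; rewrite {1}FE nE.
  move: bg bh; rewrite -/P -/Q; nra.
rewrite (ler_pM2l F0) in main.
(* With [s = t + mu], [main] reads [s ^+ 2 - s * mu + 2 * mu ^+ 2 <= s * n]. The square gives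
   [2 * mu ^+ 2 >= s * mu - s ^+ 2 / 8], with equality at [t = 3 * mu], as for the eigenvalues 6 and
   2. *)
rewrite -(ler_pM2l s0); have := sqr_ge0 (4 * mu - (t + mu)); lra.
Qed.

End ComplementaryMatrices.

(** Passing to the positive part can only increase [B w], and it does not change [w] on the support.
    The slack [mu <= a] lets the top eigenvector of [B] be used with its second eigenvalue. *)
Lemma subeigen_pospart (R : realFieldType) (I : finType) (B : I -> I -> R)
    a mu w i0 : (forall i j, 0 <= B i j) -> 0 < mu -> mu <= a ->
  (forall i, \sum_j B i j * w j = a * w i) -> 0 < w i0 ->
  subeigen B mu (fun i => Num.max (w i) 0).
Proof.
move=> B0 mu0 mua Bw wi0; have w0 i : 0 <= Num.max (w i) 0.
  by rewrite le_max lexx orbT.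
split=> [//||i] /=.
  by rewrite (bigD1 i0) //= ltr_wpDr ?sumr_ge0 // lt_max wi0.
rewrite lt_max ltxx orbF => wi.
rewrite (max_l (ltW wi)) (le_trans (ler_wpM2r (ltW wi) mua)) // -Bw.
by apply: ler_sum => j _; rewrite ler_wpM2l // le_max lexx.
Qed.

(* An eigenvector with entries of both signs gives its positive and negative
   parts; two orthogonal eigenvectors of constant sign have disjoint supports. *)
Lemma disjoint_subeigen (R : realFieldType) (I : finType) (B : I -> I -> R)
    a b mu u v : (forall i j, 0 <= B i j) -> 0 < mu -> mu <= a -> mu <= b ->
  (forall i, \sum_j B i j * u j = a * u i) ->
  (forall i, \sum_j B i j * v j = b * v i) ->
  \sum_i u i * v i = 0 -> (exists i, u i != 0) -> (exists i, v i != 0) ->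
  exists g h, [/\ subeigen B mu g, subeigen B mu h &
                  forall i, 0 < g i -> h i = 0].
Proof.
move=> B0 mu0 mua mub Bu Bv uv u0 v0.
have opp c w : (forall i, \sum_j B i j * w j = c * w i) ->
    forall i, \sum_j B i j * (- w j) = c * - w i.
  move=> Bw i; rewrite mulrN -Bw -sumrN.
  by apply: eq_bigr => j _; rewrite mulrN.
have signs c w : mu <= c -> (forall i, \sum_j B i j * w j = c * w i) ->
    (exists i, w i != 0) ->
    (exists g h, [/\ subeigen B mu g, subeigen B mu h &
                  forall i, 0 < g i -> h i = 0]) \/
    (exists e, [/\ e ^+ 2 = 1, subeigen B mu (fun i => Num.max (e * w i) 0) &
       forall i, 0 <= e * w i]).
  move=> muc Bw [k wk].
  have [/existsP[i wi]|/existsPn wN] := boolP [exists i, 0 < w i]; last first.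
    right; exists (-1); split; first by rewrite sqrrN expr1n.
      under boolp.eq_fun do rewrite mulN1r.
      apply: (subeigen_pospart (i0 := k) B0 mu0 muc (opp _ _ Bw)).
      by rewrite oppr_gt0 lt_def eq_sym wk leNgt wN.
    by move=> i; rewrite mulN1r oppr_ge0 leNgt wN.
  have [/existsP[j wj]|/existsPn wN] := boolP [exists i, 0 < - w i].
    left; exists (fun i => Num.max (w i) 0), (fun i => Num.max (- w i) 0).
    split; first exact: (subeigen_pospart (i0 := i) B0 mu0 muc Bw).
      exact: (subeigen_pospart (i0 := j) B0 mu0 muc (opp _ _ Bw)).
    by move=> l; rewrite lt_max ltxx orbF => wl; rewrite max_r // oppr_le0 ltW.
  right; exists 1; split; first by rewrite expr1n.
    under boolp.eq_fun do rewrite mul1r.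
    exact: (subeigen_pospart (i0 := i) B0 mu0 muc Bw).
  by move=> l; rewrite mul1r leNgt -oppr_gt0 wN.
have [//|[e [e1 ge eu]]] := signs a u mua Bu u0.
have [//|[d [d1 hd dv]]] := signs b v mub Bv v0.
exists (fun i => Num.max (e * u i) 0), (fun i => Num.max (d * v i) 0).
split=> // i; rewrite lt_max ltxx orbF => ui; rewrite max_l //.
(* A vanishing sum of nonnegative products has only zero terms. *)
have /eqP : \sum_i (e * u i) * (d * v i) = 0.
  under eq_bigr do rewrite mulrACA.
  by rewrite -mulr_sumr uv mulr0.
rewrite psumr_eq0 => [/allP/(_ i)|j _]; last by rewrite mulr_ge0.
by rewrite mem_index_enum mulf_eq0 gt_eqF //= => /(_ isT)/eqP.
Qed.

Lemma eigvals_sum_le (R : rcfType) n (A B : 'M[R]_n) :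
  A^T = A -> B^T = B -> (forall i j, 0 <= A i j) -> (forall i j, 0 <= B i j) ->
  (forall i j, A i j + B i j <= 1) ->
  (eigvals A)`_0 + (eigvals B)`_1 <= 8 / 7 * n%:R.
Proof.
move=> symA symB A0 B0 AB1.
have eig (M P : 'M[R]_n) (k : 'I_n) : M^T = M ->
    row k P *m M = (eigvals M)`_k *: row k P ->
    forall i, \sum_j M i j * P k j = (eigvals M)`_k * P k i.
  move=> symM /rowP Mk i; have := Mk i; rewrite !mxE => <-.
  by apply: eq_bigr => j _; rewrite mxE mulrC -[M in LHS]symM mxE.
have nz (P : 'M[R]_n) k : P *m P^T = 1%:M -> exists i, P k i != 0.
  move=> /matrixP/(_ k k); rewrite !mxE eqxx mulr1n => P1.
  apply/existsP; apply: contraPT (oner_neq0 R) => /existsPn P0.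
  rewrite -P1 big1 ?eqxx // => i _.
  by have := P0 i; rewrite negbK => /eqP->; rewrite mul0r.
have [n0|n0] := posnP n.
  (* For [n = 0] both eigenvalues are the default 0. *)
  by rewrite !nth_default ?size_eigvals ?n0 // mulr0 addr0.
pose i0 := Ordinal n0.
have [P [PP /(_ i0)/(eig _ _ _ symA) PA]] := sym_spectral symA.
rewrite /= in PA; set t := (eigvals A)`_0 in PA *.
set mu := (eigvals B)`_1.
pose f i := `|P i0 i|.
(* The triangle inequality yields the bound for [|t|], which dominates [t]. *)
have Af i : `|t| * f i <= \sum_j A i j * f j.
  rewrite /f -normrM -PA; apply: le_trans (ler_norm_sum _ _ _) _.
  by apply: ler_sum => j _; rewrite normrM ger0_norm.
have f0 i : 0 <= f i by rewrite normr_ge0.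
have F0 : 0 < \sum_i f i.
  have [i Pi] := nz P i0 PP.
  by rewrite (bigD1 i) //= ltr_wpDr ?sumr_ge0 // normr_gt0.
have tt := ler_norm t; have n1 := ler0n R n.
have [mu_le0|mu0] := lerP mu 0.
  have := subeigenvalue_le_card B0 AB1 f0 F0 Af; rewrite card_ord; lra.
(* For [n = 1] the second eigenvalue would be the default 0, against [mu > 0]. *)
have n1' : (1 < n)%N.
  rewrite ltnNge; apply/negP => n_le1; move: mu0.
  by rewrite /mu nth_default ?ltxx // size_eigvals.
pose i1 := Ordinal n1'.
have [Q [QQ QB]] := sym_spectral symB.
have [g [h [sg sh gh]]] : exists g h,
    [/\ subeigen B mu g, subeigen B mu h & forall i, 0 < g i -> h i = 0].
  apply: (disjoint_subeigen B0 mu0 _ _ (eig _ _ _ symB (QB i0))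
            (eig _ _ _ symB (QB i1))) => //; try exact: nz.
    by rewrite eigvals_nonincr.
  have /matrixP/(_ i0 i1) := QQ; rewrite !mxE /= mulr0n => QQ01.
  by rewrite -[RHS]QQ01; apply: eq_bigr => j _; rewrite mxE.
have symB' i j : B i j = B j i by rewrite -[in LHS]symB mxE.
have := disjoint_supports_bound symB' A0 B0 AB1 (normr_ge0 t) f0 F0 Af mu0 sg sh gh.
rewrite card_ord; lra.
Qed.

(** * Quadratic forms of graphs and of blowups *)

Lemma form_embed (R : comNzRingType) n (U : finType) (phi : U -> 'I_n)
    (A : 'M[R]_n) (y z : U -> R) :
  ((\sum_u y u *: delta_mx 0 (phi u) : 'rV_n) *m A *m
   (\sum_u z u *: delta_mx 0 (phi u) : 'rV_n)^T) 0 0 =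
  \sum_u \sum_v y u * z v * A (phi u) (phi v).
Proof.
rewrite linear_sum /= -mulmxA mulmx_suml summxE; apply: eq_bigr => u _.
rewrite !mulmx_sumr summxE; apply: eq_bigr => v _.
rewrite linearZ /= -!scalemxAr -scalemxAl trmx_delta mulmxA.
rewrite -rowE -colE !mxE; ring.
Qed.

Lemma adjmx_rank (R : nzRingType) (T : finType) (e : rel T) x y :
  adjmx R e (enum_rank x) (enum_rank y) = (e x y)%:R.
Proof. by rewrite mxE !enum_rankK. Qed.

Lemma adjmx_sym (R : nzRingType) (T : finType) (e : rel T) :
  symmetric e -> (adjmx R e)^T = adjmx R e.
Proof. by move=> sym_e; apply/matrixP => i j; rewrite !mxE sym_e. Qed.

(** Edge-disjointness is common to both kinds of complement, so one bound serves simple and looped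
    graphs. *)
Lemma lambda_sum_disjoint_le (R : rcfType) (T : finType) (e1 e2 : rel T) :
  symmetric e1 -> symmetric e2 -> (forall x y, ~~ (e1 x y && e2 x y)) ->
  lambda R 1 e1 + lambda R 2 e2 <= 8 / 7 * #|T|%:R.
Proof.
move=> sym1 sym2 e12; apply: eigvals_sum_le; rewrite ?adjmx_sym // => i j.
- by rewrite mxE ler0n.
- by rewrite mxE ler0n.
- rewrite !mxE -natrD (ler_nat _ _ 1%N).
  by have := e12 (enum_val i) (enum_val j); do 2?case: (_ (enum_val i) _).
Qed.

Section Blowup.
Context {R : rcfType} {S T : finType}.
Variables (t : nat) (e0 : rel S) (e : rel T) (psi : S * 'I_t -> T).
Variable loops : bool.
Hypotheses (t_gt0 : (0 < t)%N) (psi_inj : injective psi) (sym_e : symmetric e).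
Hypothesis psi_e :
  forall u v, e (psi u) (psi v) = blowup t e0 u v && (loops || (u != v)).

(** Constant on the copies of each vertex and zero off the image of [psi], so [T] may have vertices
    outside the blowup. *)
Let emb (y : S -> R) : 'rV[R]_#|T| :=
  \sum_(u : S * 'I_t) y u.1 *: delta_mx 0 (enum_rank (psi u)).

Lemma sum_fst (F : S -> R) : \sum_(u : S * 'I_t) F u.1 = t%:R * \sum_s F s.
Proof.
rewrite -(pair_bigA _ (fun s _ => F s)) mulr_sumr /=.
by apply: eq_bigr => s _; rewrite sumr_const card_ord mulr_natl.
Qed.

Lemma emb_normsq y : (emb y *m (emb y)^T) 0 0 = t%:R * \sum_s y s ^+ 2.
Proof.
rewrite -sum_fst -[emb y in X in X *m _]mulmx1 form_embed.
apply: eq_bigr => u _; rewrite (bigD1 u) //= big1 ?addr0.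
  by rewrite mxE eqxx mulr1 expr2.
move=> v vu; rewrite mxE (inj_eq enum_rank_inj) (inj_eq psi_inj) eq_sym.
by rewrite (negbTE vu) mulr0.
Qed.

(** The form of the full blowup is [t ^+ 2] times that of [e0], and the squared norm is [t] times
    that of [y]. Deleting loops lowers the form by at most one squared norm. *)
Lemma emb_form_ge y c : c * \sum_s y s ^+ 2 <=
    \sum_s \sum_s' y s * y s' * (e0 s s')%:R ->
  (t%:R * c - (~~ loops)%:R) * (emb y *m (emb y)^T) 0 0 <=
  (emb y *m adjmx R e *m (emb y)^T) 0 0.
Proof.
move=> cy; rewrite emb_normsq form_embed.
have : \sum_u \sum_v y u.1 * y v.1 * (blowup t e0 u v)%:R -
       (~~ loops)%:R * \sum_(u : S * 'I_t) y u.1 ^+ 2 <=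
    \sum_u \sum_v y u.1 * y v.1 *
      adjmx R e (enum_rank (psi u)) (enum_rank (psi v)).
  rewrite mulr_sumr -sumrB ler_sum // => u _.
  rewrite (bigD1 u) //= [leRHS](bigD1 u) //= addrAC lerD //.
    rewrite adjmx_rank psi_e eqxx orbF; have := sqr_ge0 (y u.1).
    by case: loops; case: (blowup _ _ _ _) => /=; rewrite ?mulr0n ?mulr1n; lra.
  apply: ler_sum => v vu; rewrite adjmx_rank psi_e eq_sym vu orbT andbT //.
apply: le_trans.
have -> : \sum_u \sum_v y u.1 * y v.1 * (blowup t e0 u v)%:R =
    t%:R * (t%:R * \sum_s \sum_s' y s * y s' * (e0 s s')%:R).
  rewrite -sum_fst mulr_sumr; apply: eq_bigr => u _.
  exact: (sum_fst (fun s => y u.1 * y s * (e0 u.1 s)%:R)).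
rewrite (sum_fst (fun s => y s ^+ 2)).
have := ler_wpM2l (ler0n R t) (ler_wpM2l (ler0n R t) cy); nra.
Qed.

Lemma emb_neq0 y : 0 < \sum_s y s ^+ 2 -> emb y != 0.
Proof.
by move=> y0; rewrite -dot_eq0 emb_normsq gt_eqF // mulr_gt0 // ltr0n.
Qed.

Lemma le_lambda1_blowup c y : 0 < \sum_s y s ^+ 2 ->
  c * \sum_s y s ^+ 2 <= \sum_s \sum_s' y s * y s' * (e0 s s')%:R ->
  t%:R * c - (~~ loops)%:R <= lambda R 1 e.
Proof.
move=> y0 cy; apply: (le_eigval0 (adjmx_sym R sym_e) (emb_neq0 y0)).
exact: emb_form_ge.
Qed.

Lemma le_lambda2_blowup c f g :
  (forall a b, (a != 0) || (b != 0) -> let y s := a * f s + b * g s in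
    0 < \sum_s y s ^+ 2 /\
    c * \sum_s y s ^+ 2 <= \sum_s \sum_s' y s * y s' * (e0 s s')%:R) ->
  t%:R * c - (~~ loops)%:R <= lambda R 2 e.
Proof.
move=> fg; apply: (le_eigval1 (f := emb f) (g := emb g) (adjmx_sym R sym_e)).
move=> a b /fg /= [y0 cy].
have -> : a *: emb f + b *: emb g = emb (fun s => a * f s + b * g s).
  rewrite /emb !scaler_sumr -big_split /=; apply: eq_bigr => u _.
  by rewrite !scalerA -scalerDl.
by split; [exact: emb_neq0 | exact: emb_form_ge].
Qed.

End Blowup.

(** * Test vectors for [J3_join_C4] and its looped complement *)

Lemma J3_join_C4_sym : symmetric J3_join_C4.
Proof. by move=> [x|x] [y|y] //=; rewrite /cycle_graph /= orbC. Qed.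

Lemma big_J3_C4 (R : nmodType) (F : 'I_3 + 'I_4 -> R) :
  \sum_s F s = F (inl (inord 0)) + F (inl (inord 1)) + F (inl (inord 2)) +
    F (inr (inord 0)) + F (inr (inord 1)) + F (inr (inord 2)) +
    F (inr (inord 3)).
Proof.
rewrite big_sumType /= !big_ord_recl !big_ord0 !addr0 !addrA.
by do !congr (_ + _); congr (F _); congr (_ _); apply: val_inj; rewrite /= inordK.
Qed.

(** An eigenvector for 6: the neighbour sums are [3 * 4 + 4 * 3 = 6 * 4] on the first part and
    [3 * 4 + 2 * 3 = 6 * 3] on the second. *)
Definition perron_weight (R : nzRingType) (s : 'I_3 + 'I_4) : R :=
  if s is inl _ then 4 else 3.

(** In the looped complement each parity class of the 4-cycle is an all-ones block of order 2, with
    eigenvalue 2. *)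
Definition parity_weight (R : nzRingType) (b : bool) (s : 'I_3 + 'I_4) : R :=
  if s is inr k then (odd k == b)%:R else 0.

Section LowerBounds.
Context {R : rcfType} {T : finType}.
Variables (t : nat) (e : rel T) (psi : ('I_3 + 'I_4) * 'I_t -> T).
Variable loops : bool.
Hypotheses (t_gt0 : (0 < t)%N) (psi_inj : injective psi) (sym_e : symmetric e).

Lemma lambda1_J3_join_C4_ge :
  (forall u v, e (psi u) (psi v) =
     blowup t J3_join_C4 u v && (loops || (u != v))) ->
  t%:R * 6 - (~~ loops)%:R <= lambda R 1 e.
Proof.
move=> psi_e.
apply: (le_lambda1_blowup t_gt0 psi_inj sym_e psi_e (y := perron_weight R)).
  by rewrite big_J3_C4 /=; lra.
rewrite !big_J3_C4 /= /cycle_graph /= !inordK //=; lra.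
Qed.

Lemma lambda2_looped_compl_J3_join_C4_ge :
  (forall u v, e (psi u) (psi v) =
     blowup t (looped_compl J3_join_C4) u v && (loops || (u != v))) ->
  t%:R * 2 - (~~ loops)%:R <= lambda R 2 e.
Proof.
move=> psi_e; apply: (le_lambda2_blowup t_gt0 psi_inj sym_e psi_e
  (f := parity_weight R false) (g := parity_weight R true)).
move=> a b ab y; rewrite {}/y !big_J3_C4 /looped_compl /= /cycle_graph /=.
rewrite !inordK //= !(mulr0, mul0r, mulr1, addr0, add0r).
have ab0 : 0 < a ^+ 2 + b ^+ 2.
  by rewrite lt_def paddr_eq0 ?sqr_ge0 // !sqrf_eq0 negb_and ab addr_ge0 ?sqr_ge0.
by split; lra.
Qed.

End LowerBounds.

(** * Simple graphs on [n] vertices and the limit *)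

(** The blowup without its loops sits on the first [7 * t] vertices and the others are isolated; the
    bound is [(6 * t - 1) + (2 * t - 1)]. *)
Lemma simple_lambda_sum_ge (R : rcfType) n t : (0 < t)%N -> (7 * t <= n)%N ->
  exists2 E : 'M[bool]_n, is_simple E &
    t%:R * 8 - 2 <= lambda_sum R 1 2 E.
Proof.
move=> t_gt0 le_tn; pose U := (('I_3 + 'I_4) * 'I_t)%type.
have leU : (#|{: U}| <= n)%N by rewrite card_prod card_sum !card_ord.
pose psi (u : U) := widen_ord leU (enum_rank u).
have psi_inj : injective psi.
  by move=> u v /(congr1 val) /= /val_inj /enum_rank_inj.
pose G := blowup t J3_join_C4.
have symG : symmetric G by move=> u v; apply: J3_join_C4_sym.
pose E : 'M[bool]_n := \matrix_(i, j)
  [exists u, exists v, [&& psi u == i, psi v == j, G u v & u != v]].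
have EE u v : E (psi u) (psi v) = G u v && (u != v).
  rewrite mxE; apply/existsP/idP => [[u' /existsP[v']]|uv].
    by case/and3P => /eqP/psi_inj-> /eqP/psi_inj->.
  by exists u; apply/existsP; exists v; rewrite !eqxx.
have symE : symmetric E.
  move=> i j; rewrite !mxE; apply/existsP/existsP => -[u /existsP[v]];
    case/and4P => ui vj Guv uv; exists v; apply/existsP; exists u;
    by rewrite ui vj symG Guv eq_sym uv.
have simE : is_simple E.
  apply/andP; split; first by apply/eqP/matrixP => i j; rewrite mxE symE.
  apply/forallP => i; rewrite mxE; apply/existsP => -[u /existsP[v]].
  by case/and4P => /eqP <- /eqP/psi_inj-> _; rewrite eqxx.
exists E => //; rewrite /lambda_sum.
have l1 : t%:R * 6 - 1 <= lambda R 1 E.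
  exact: (lambda1_J3_join_C4_ge (loops := false) t_gt0 psi_inj symE EE).
have l2 : t%:R * 2 - 1 <= lambda R 2 (simple_compl E).
  apply: (lambda2_looped_compl_J3_join_C4_ge (loops := false) t_gt0 psi_inj).
    by move=> i j; rewrite /simple_compl /= eq_sym symE.
  move=> u v; rewrite /simple_compl /= EE (inj_eq psi_inj).
  by case: (u == v); rewrite /= ?andbF ?andbT.
lra.
Qed.

Lemma simple_lambda_sum_le (R : rcfType) n (E : 'M[bool]_n) : is_simple E ->
  lambda_sum R 1 2 E <= 8 / 7 * n%:R.
Proof.
case/andP => /eqP/matrixP symE _.
have sE : symmetric E by move=> i j; rewrite -[in LHS]symE mxE.
rewrite -[in n%:R](card_ord n); apply: lambda_sum_disjoint_le => //.
  by move=> i j; rewrite /simple_compl /= eq_sym sE.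
by move=> i j; rewrite /simple_compl /=; case: (E i j); rewrite ?andbF.
Qed.

Lemma is_simple0 n : is_simple (const_mx false : 'M[bool]_n).
Proof.
apply/andP; split; first by apply/eqP/matrixP => i j; rewrite !mxE.
by apply/forallP => i; rewrite mxE.
Qed.

Lemma max_lambda_sum_le (R : rcfType) n :
  max_lambda_sum R 1 2 n <= 8 / 7 * n%:R.
Proof.
rewrite /max_lambda_sum; case: arg_maxP => [|E simE _]; first exact: is_simple0.
exact: simple_lambda_sum_le.
Qed.

(** With [t = n %/ 7] one has [n <= 7 * t + 6], so [8 / 7 * n <= 8 * t + 48 / 7 <= 8 * t + 7]; the 2
    lost to loops makes 9. *)
Lemma max_lambda_sum_ge (R : rcfType) n : (7 <= n)%N ->
  8 / 7 * n%:R - 9 <= max_lambda_sum R 1 2 n.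
Proof.
move=> n7; have nE := divn_eq n 7; have lt7 := ltn_mod n 7.
have [||E simE leE] := @simple_lambda_sum_ge R n (n %/ 7).
- by rewrite divn_gt0.
- by rewrite mulnC leq_trunc_div.
have : lambda_sum R 1 2 E <= max_lambda_sum R 1 2 n.
  rewrite /max_lambda_sum; case: arg_maxP => [|F _]; first exact: is_simple0.
  by apply.
apply: le_trans; apply: le_trans leE.
have : n%:R <= (7 * (n %/ 7) + 6)%:R :> R by rewrite ler_nat; lia.
rewrite natrD natrM; lra.
Qed.

Lemma cvg_alpha_seq (R : realType) :
  (alpha_seq R 1 2 @ \oo --> (8 / 7 : R))%classic.
Proof.
apply: (@squeeze_cvgr _ _ _ _ (fun n => 8 / 7 - 18 * harmonic n) (fun=> 8 / 7)).
- near=> n; have n7 : (7 <= n)%N by near: n; exists 7.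
  have n0 : 0 < n%:R :> R by rewrite ltr0n; lia.
  rewrite /alpha_seq ler_pdivlMr // ler_pdivrMr // max_lambda_sum_le andbT.
  apply: le_trans (max_lambda_sum_ge R n7).
  (* [harmonic n] is the inverse of [n.+1], and [n.+1 <= 2 * n] here, hence 18 in place of 9. *)
  have : 9 <= 18 * harmonic n * n%:R :> R.
    rewrite /harmonic mulrAC ler_pdivlMr ?ltr0n // -!natrM ler_nat; lia.
  lra.
- have : (8 / 7 - 18 * harmonic n @[n --> \oo] --> (8 / 7 - 18 * 0 : R))%classic.
    exact: (cvgB (cvg_cst _) (cvgM (cvg_cst _) cvg_harmonic)).
  by rewrite mulr0 subr0.
- exact: cvg_cst.
Unshelve. all: by end_near. Qed.

Theorem theorem3 (R : realType) :
  [/\ cvgn (alpha_seq R 1 2), alpha R 1 2 = 8 / 7 &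
      forall t : nat, (1 <= t)%N ->
        let G := blowup t J3_join_C4 in
        let n := #|{: ('I_3 + 'I_4) * 'I_t}| in
        [/\ n = (7 * t)%N,
            lambda R 1 G + lambda R 2 (looped_compl G) = 8 / 7 * n%:R &
            forall H : rel 'I_n, symmetric H ->
              lambda R 1 H + lambda R 2 (looped_compl H) <=
              lambda R 1 G + lambda R 2 (looped_compl G)]].
Proof.
have looped_le (T : finType) (e : rel T) : symmetric e ->
    lambda R 1 e + lambda R 2 (looped_compl e) <= 8 / 7 * #|T|%:R.
  move=> sym_e; apply: lambda_sum_disjoint_le => // x y.
    by rewrite /looped_compl /= sym_e.
  by rewrite /looped_compl /= andbN.
split; [exact: cvgP (@cvg_alpha_seq R) | exact: cvg_lim (@cvg_alpha_seq R) |].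
move=> t t_gt0 G n.
have symG : symmetric G by move=> u v; apply: J3_join_C4_sym.
have nE : n = (7 * t)%N by rewrite /n card_prod card_sum !card_ord.
have GE : lambda R 1 G + lambda R 2 (looped_compl G) = 8 / 7 * n%:R.
  (* With loops kept and [psi = id] nothing is lost: [6 * t + 2 * t] meets the upper bound
     [8 / 7 * (7 * t)]. *)
  apply/eqP; rewrite eq_le looped_le //=.
  have l1 : t%:R * 6 - 0 <= lambda R 1 G.
    apply: (lambda1_J3_join_C4_ge (loops := true) t_gt0 (psi := id)) => //.
    by move=> u v; rewrite andbT.
  have l2 : t%:R * 2 - 0 <= lambda R 2 (looped_compl G).
    apply: (lambda2_looped_compl_J3_join_C4_ge (loops := true) t_gt0 (psi := id)) => //.
      by move=> u v; rewrite /looped_compl /= symG.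
    by move=> u v; rewrite andbT.
  rewrite nE natrM; lra.
split=> // H symH; rewrite GE; have := looped_le _ H symH.
by rewrite card_ord.
Qed.
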